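(* Let $p$ be an odd prime and let $G$ be a group with $|G|=p^n$ and $|Z(G)|=p^{n-2}$. Let $\Gamma=\zeta(G,G)$ be the commuting graph of $G$, and let $$C_Q(S_1)=\begin{pmatrix} p^{n-2}+p^n-2 & p^{n-2}\sqrt{p^2-1}\\ p^{n-2}\sqrt{p^2-1} & 2p^{n-1}-p^{n-2}-2\end{pmatrix}.$$ Then the signless Laplacian spectrum of $\Gamma$ is $\operatorname{Spec}_Q(\Gamma)=\operatorname{Spec}(C_Q(S_1))\cup A$, where $$A=\left\{(p^{n}-2)^{p^{n-2}-1},\ (2p^{n-1}-p^{n-2}-2)^{p},\ (p^{n-1}-2)^{p^n-p^{n-2}-p-1}\right\}.$$
   Context: $Z(G)$ is the center of $G$. The commuting graph $\zeta(G,G)$ is the simple graph with vertex set $G$ in which two distinct vertices are adjacent if and only if they commute in $G$. For a graph $\Gamma$ with adjacency matrix $A(\Gamma)$ and diagonal degree matrix $D(\Gamma)$, the signless Laplacian matrix is $Q(\Gamma)=D(\Gamma)+A(\Gamma)$, and $\operatorname{Spec}_Q(\Gamma)$ is the spectrum of $Q(\Gamma)$. Spectra are multisets of eigenvalues: $\{\lambda_1^{m_1},\dots,\lambda_k^{m_k}\}$ denotes the multiset in which $\lambda_i$ occurs with multiplicity $m_i$ (the exponents are multiplicities, not powers), and $\cup$ is union of multisets with multiplicities added. $\operatorname{Spec}(M)$ is the spectrum of the matrix $M$. *)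

(* Defs.v *)
From mathcomp Require Import all_boot all_order all_algebra all_fingroup.
From mathcomp Require Import center finmap multiset.

Set Implicit Arguments.
Unset Strict Implicit.
Unset Printing Implicit Defensive.

Import Order.TTheory GRing.Theory Num.Theory.
Local Open Scope ring_scope.

Record sgraph := SGraph {
  vertex :> finType;
  adj : rel vertex;
  adj_sym : symmetric adj;
  adj_irr : irreflexive adj }.

Section GraphMatrices.
Variables (R : pzRingType) (Gamma : sgraph).

Definition degree (v : Gamma) : nat := #|[set w | adj v w]|.

(* Rows and columns are indexed by 'I_#|Gamma| through enum_val. *)
Definition adjacency_mx : 'M[R]_#|Gamma| :=
  \matrix_(i, j) (adj (enum_val i) (enum_val j))%:R.

Definition degree_mx : 'M[R]_#|Gamma| :=
  diag_mx (\row_i (degree (enum_val i))%:R).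

Definition signless_laplacian_mx : 'M[R]_#|Gamma| := degree_mx + adjacency_mx.

End GraphMatrices.

Section CommutingGraph.
Variables (gT : finGroupType) (G : {group gT}).

Definition commuting_adj : rel [subg G] :=
  [rel x y | (x != y) && (x * y == y * x)%g].

Fact commuting_adj_sym : symmetric commuting_adj.
Proof. by move=> x y /=; congr (~~ _ && _); apply: eq_sym. Qed.

Fact commuting_adj_irr : irreflexive commuting_adj.
Proof. by move=> x; rewrite /commuting_adj /= eqxx. Qed.

Definition commuting_graph : sgraph :=
  SGraph commuting_adj_sym commuting_adj_irr.

End CommutingGraph.

Section Spectrum.
Variables (C : numClosedFieldType) (n : nat).
Implicit Types (M : 'M[C]_n) (x : C).
Local Open Scope fset_scope.
Local Open Scope mset_scope.

(* The explicit root list only provides the finite support; the multiplicity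
   of every x is the one given by Spec_mup. *)
Definition Spec M : {mset C} :=
  [fsfun x in [fset y | y in sval (closed_field_poly_normal (char_poly M))]
     => mup x (char_poly M)].

Lemma Spec_mup M x : Spec M x = mup x (char_poly M).
Proof.
rewrite /Spec fsfunE; case: ifPn => //.
case: closed_field_poly_normal => s /= Es x_s; apply/esym/mupNroot.
apply: contra x_s; rewrite {1}Es (monicP (char_poly_monic M)) scale1r.
by rewrite root_prod_XsubC => x_s; apply/imfsetP; exists x.
Qed.

Lemma in_Spec M x : (x \in Spec M) = eigenvalue M x.
Proof.
have nz : char_poly M != 0 by rewrite monic_neq0 ?char_poly_monic.
rewrite eigenvalue_root_char -mset_gt0 Spec_mup.
by rewrite mup_geq // expr1 dvdp_XsubCl.
Qed.

End Spectrum.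

Definition Spec_Q (C : numClosedFieldType) (Gamma : sgraph) : {mset C}%mset :=
  Spec (signless_laplacian_mx C Gamma).

Definition CQ_S1 (C : numClosedFieldType) (p n : nat) : 'M[C]_2 :=
  let P (k : nat) : C := p%:R ^+ k in
  let b := P (n - 2)%N * sqrtC (p%:R ^+ 2 - 1) in
  block_mx (P (n - 2)%N + P n - 2)%:M b%:M
           b%:M (2 * P (n - 1)%N - P (n - 2)%N - 2)%:M :> 'M[C]_(1 + 1).

(* Main.v *)
(** In a group of order p^n whose centre Z has index p^2, every centralizer of a
    noncentral element is abelian of order p^(n-1), so two noncentral elements
    commute exactly when they have the same centralizer. The commuting graph is
    therefore the join of the clique on Z with p + 1 disjoint cliques of size
    p^(n-1) - p^(n-2). With U the incidence matrix of these cliques, x - Q is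
    D - U U^T minus a matrix of rank 2, where D is diagonal and constant on Z and
    on its complement; two applications of det(1 - AB) = det(1 - BA) then give
    the characteristic polynomial at every x avoiding three exceptional values,
    which determines it. *)
Require Import Defs.
From mathcomp Require Import all_boot all_order all_algebra all_fingroup.
From mathcomp Require Import center finmap multiset ring zify.

Import Order.TTheory GRing.Theory Num.Theory.

Set Implicit Arguments.
Unset Strict Implicit.
Unset Printing Implicit Defensive.
Local Open Scope ring_scope.

(** * Determinants and identities between polynomials *)

(** Sylvester's identity: one block matrix is factored into block triangular matrices in two
    ways. *)
Lemma det_sub1_mulmxC (R : comNzRingType) (m n : nat)
    (A : 'M[R]_(m, n)) (B : 'M[R]_(n, m)) :
  \det (1%:M - A *m B) = \det (1%:M - B *m A).
Proof.
transitivity (\det (block_mx 1%:M A B 1%:M)).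
  have -> : block_mx 1%:M A B 1%:M =
            block_mx 1%:M A 0 1%:M *m block_mx (1%:M - A *m B) 0 B 1%:M.
    by rewrite mulmx_block !mul1mx !mulmx1 !mul0mx !add0r addrNK.
  by rewrite det_mulmx det_ublock det_lblock !det1 !mul1r mulr1.
have -> : block_mx 1%:M A B 1%:M =
          block_mx 1%:M 0 B 1%:M *m block_mx 1%:M A 0 (1%:M - B *m A).
  by rewrite mulmx_block !mul1mx !mulmx1 !mul0mx !addr0 addrC addrNK.
by rewrite det_mulmx det_lblock det_ublock !det1 !mul1r.
Qed.

(** [U'] stands for [M^-1 *m U]; supplying it as a solution of [M *m U' = U] avoids computing an
    inverse. The matrix then factors as [M *m (1%:M - U' *m V)]. *)
Lemma det_sub_mulmx (R : comNzRingType) (m n : nat) (M : 'M[R]_m)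
    (U U' : 'M[R]_(m, n)) (V : 'M[R]_(n, m)) :
  M *m U' = U -> \det (M - U *m V) = \det M * \det (1%:M - V *m U').
Proof.
move=> <-; rewrite -det_sub1_mulmxC -det_mulmx.
by rewrite mulmxBr mulmx1 mulmxA.
Qed.

Lemma det_block_scalar2 (R : comNzRingType) (a b c d : R) :
  \det (block_mx a%:M b%:M c%:M d%:M : 'M_(1 + 1)) = a * d - b * c.
Proof.
set M := block_mx _ _ _ _.
rewrite (expand_det_row M (lshift 1 0)) big_split_ord !big_ord1 /=.
rewrite /cofactor !det_mx11 !mxE /=.
have -> : lift (lshift 1 (ord0 : 'I_1)) (ord0 : 'I_1) = rshift 1 (ord0 : 'I_1).
  exact/val_inj.
have -> : lift (rshift 1 (ord0 : 'I_1)) (ord0 : 'I_1) = lshift 1 (ord0 : 'I_1).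
  exact/val_inj.
rewrite !(unsplitK (inl _)) !(unsplitK (inr _)) !row_mxEl !row_mxEr !mxE /=.
by rewrite !mulr1n expr0 mul1r expr1 mulN1r mulrN.
Qed.

(** [(p - q) * r] vanishes everywhere, in particular at more naturals than its degree, and these are
    distinct in characteristic 0. This allows a characteristic polynomial to be computed only where
    the divisions make sense. *)
Lemma eq_poly_generic (F : numFieldType) (r p q : {poly F}) :
  r != 0 -> (forall x, r.[x] != 0 -> p.[x] = q.[x]) -> p = q.
Proof.
move=> r_nz eq_pq; apply/eqP; rewrite -subr_eq0.
suff /eqP : (p - q) * r = 0 by rewrite mulf_eq0 (negPf r_nz) orbF.
apply: (@roots_geq_poly_eq0 _ _ [seq i%:R | i <- iota 0 (size ((p - q) * r))]).
- apply/allP=> x _; rewrite /root hornerM.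
  have [->|rx_nz] := eqVneq r.[x] 0; first by rewrite mulr0.
  by rewrite hornerD hornerN eq_pq ?subrr ?mul0r.
- by rewrite map_inj_uniq ?iota_uniq //; apply: mulrIn; rewrite oner_eq0.
- by rewrite size_map size_iota.
Qed.

Lemma horner_char_poly (R : comNzRingType) (n : nat) (M : 'M[R]_n) (x : R) :
  (char_poly M).[x] = \det (x%:M - M).
Proof.
rewrite -[LHS]/(horner_eval x _) /char_poly -det_map_mx; congr (\det _).
apply/matrixP=> i j; rewrite /char_poly_mx !mxE /= /horner_eval
  hornerD hornerN hornerC.
by rewrite hornerMn hornerX.
Qed.

(** * Incidence matrix of a partition of the complement of [Z] *)

Section Indicator.
Variables (R : comNzRingType) (T : finType).

Definition indicator (A : {set T}) : 'cV[R]_#|T| :=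
  \col_i (enum_val i \in A)%:R.

Definition incidence_mx (P : {set {set T}}) : 'M[R]_(#|T|, #|P|) :=
  \matrix_(i, j) (enum_val i \in (enum_val j : {set T}))%:R.

Lemma sum_enum_val (V : nmodType) (F : T -> V) :
  \sum_(i < #|T|) F (enum_val i) = \sum_x F x.
Proof. by rewrite -(@big_enum_val _ _ _ T predT F). Qed.

Lemma sum_mem (A : {set T}) : \sum_x (x \in A)%:R = #|A|%:R :> R.
Proof. by rewrite -natr_sum -sum1_card [in RHS]big_mkcond. Qed.

Lemma indicatorT_mulmx (A B : {set T}) :
  (indicator A)^T *m indicator B = #|A :&: B|%:R%:M.
Proof.
apply/matrixP=> i j; rewrite !ord1 !mxE mulr1n.
under eq_bigr do rewrite !mxE -natrM mulnb.
rewrite (sum_enum_val (fun x => ((x \in A) && (x \in B))%:R)) -sum_mem.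
by apply: eq_bigr => x _; rewrite inE.
Qed.

Variables (Z : {set T}) (P : {set {set T}}) (m : nat).
Hypothesis partP : partition P (~: Z).
Hypothesis cardP : {in P, forall B : {set T}, #|B| = m}.

Let trivP : trivIset P. Proof. by case/and3P: partP. Qed.
Let coverP : cover P = ~: Z. Proof. by case/and3P: partP=> /eqP. Qed.

(** A point outside [Z] lies in exactly one block, and a point of [Z] in none, so at most one term
    survives. *)
Lemma sum_blocks (F : {set T} -> R) x :
  \sum_(j < #|P|) (x \in (enum_val j : {set T}))%:R * F (enum_val j)
  = (x \notin Z)%:R * F (pblock P x).
Proof.
transitivity (\sum_(B in P) (x \in B)%:R * F B).
  by rewrite [RHS]big_enum_val.
have [xZ|xZ] := boolP (x \in Z).
  rewrite mul0r big1 // => B PB.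
  case: (boolP (x \in B)) => [xB|]; last by rewrite mul0r.
  have : x \in cover P by apply/bigcupP; exists B.
  by rewrite coverP inE xZ.
have xP : x \in cover P by rewrite coverP inE.
rewrite (bigD1 (pblock P x)) ?pblock_mem //= mem_pblock xP big1 ?addr0 //.
move=> B /andP[PB]; case: (boolP (x \in B)) => [xB|_ _]; last by rewrite mul0r.
by rewrite (def_pblock trivP PB xB) eqxx.
Qed.

Lemma incidence_mulT :
  incidence_mx P *m (incidence_mx P)^T =
  \matrix_(i, j) ((enum_val i \notin Z) && (enum_val j \notin Z)
                  && (pblock P (enum_val i) == pblock P (enum_val j)))%:R.
Proof.
apply/matrixP=> i j; rewrite !mxE.
under eq_bigr do rewrite !mxE.
rewrite (sum_blocks (fun B => (enum_val j \in B)%:R)) -natrM mulnb -andbA.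
congr (nat_of_bool _)%:R; case: (boolP (enum_val i \in Z)) => //= iZ.
have iP : enum_val i \in cover P by rewrite coverP inE.
rewrite (eq_pblock _ trivP iP); case: (boolP (_ \in pblock _ _)) => [jP|].
  rewrite andbT -in_setC -coverP; apply/esym/bigcupP.
  by exists (pblock P (enum_val i)); rewrite ?pblock_mem.
by rewrite andbF.
Qed.

Lemma incidenceT_mul : (incidence_mx P)^T *m incidence_mx P = m%:R%:M.
Proof.
apply/matrixP=> i j; rewrite !mxE.
under eq_bigr do rewrite !mxE -natrM mulnb.
rewrite (sum_enum_val (fun x => ((x \in enum_val i) && (x \in enum_val j))%:R)).
under eq_bigr do rewrite -in_setI.
rewrite sum_mem; case: (eqVneq i j) => [->|ij].
  by rewrite setIid cardP ?enum_valP ?mulr1n.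
rewrite disjoint_setI0 ?cards0 ?mulr0n //.
move/trivIsetP: trivP => /(_ _ _ (enum_valP i) (enum_valP j)); apply.
by apply: contra ij => /eqP/enum_val_inj ->.
Qed.

Lemma incidence_mul1 : incidence_mx P *m const_mx 1 = indicator (~: Z).
Proof.
apply/matrixP=> i j; rewrite !mxE.
under eq_bigr do rewrite !mxE.
by rewrite (sum_blocks (fun=> 1)) mulr1 inE.
Qed.

Lemma incidenceT_indicator : (incidence_mx P)^T *m indicator Z = 0.
Proof.
apply/matrixP=> i j; rewrite !mxE big1 // => k _; rewrite !mxE.
case: (boolP (_ \in enum_val i)) => [ki|]; last by rewrite mul0r.
have: enum_val k \in cover P.
  by apply/bigcupP; exists (enum_val i); rewrite ?enum_valP.
by rewrite coverP inE => /negbTE->; rewrite mulr0.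
Qed.

End Indicator.

(** * Characteristic polynomial of a clique joined to disjoint cliques *)

(** The last product has entry 1 exactly where the row or the column lies in [Z], so it encodes the
    join; the incidence product encodes the cliques outside [Z]. Both have ones on the diagonal,
    which [a] and [b] must compensate. *)
Lemma det_join_cliques (F : fieldType) (T : finType) (Z : {set T})
    (P : {set {set T}}) (m : nat) (a b : F) :
    partition P (~: Z) -> {in P, forall B : {set T}, #|B| = m} ->
    (0 < #|Z|)%N -> (0 < #|P|)%N -> (0 < m)%N ->
    a != 0 -> b != 0 -> b - m%:R != 0 ->
  let z := #|Z| in let k := #|P| in let c := b - m%:R in
  \det (diag_mx (\row_i (if enum_val i \in Z then a else b))
        - incidence_mx F P *m (incidence_mx F P)^T
        - row_mx (indicator F Z) (indicator F (~: Z))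
          *m col_mx (indicator F [set: T])^T (indicator F Z)^T)
  = a ^+ z.-1 * b ^+ (k * m.-1) * c ^+ k.-1 * ((a - z%:R) * c - (k * m * z)%:R).
Proof.
move=> partP cardP z_gt0 k_gt0 m_gt0 a_nz b_nz c_nz /=.
set z := #|Z|; set k := #|P|; set c := b - m%:R.
set D := diag_mx _; set U := incidence_mx F P.
have cardCZ : #|~: Z| = (k * m)%N by apply: card_uniform_partition partP.
have indU : U *m const_mx 1 = indicator F (~: Z) by apply: incidence_mul1.
have DZ : D *m indicator F Z = a *: indicator F Z.
  apply/matrixP=> i j; rewrite mul_diag_mx !mxE.
  by case: ifP; rewrite ?mulr0.
have DCZ : D *m indicator F (~: Z) = b *: indicator F (~: Z).
  apply/matrixP=> i j; rewrite mul_diag_mx !mxE inE.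
  by case: ifP; rewrite ?mulr0.
have DU : D *m U = b *: U.
  apply/matrixP=> i j; rewrite mul_diag_mx !mxE.
  case: (boolP (_ \in enum_val j)) => [ij|]; rewrite ?mulr0 // !mulr1.
  have : enum_val i \in cover P.
    by apply/bigcupP; exists (enum_val j); rewrite ?enum_valP.
  by case/and3P: partP => /eqP-> _ _; rewrite inE => /negbTE->.
have UU : U^T *m U = m%:R%:M by apply: incidenceT_mul partP cardP.
have detD : \det D = a ^+ z * b ^+ (k * m).
  rewrite det_diag; under eq_bigr do rewrite mxE.
  rewrite -(@big_enum_val _ _ _ T predT (fun x => if x \in Z then a else b)).
  rewrite (bigID (mem Z)) /=; congr (_ * _).
    rewrite -prodr_const; apply: eq_big => [//|x]; by case: ifP.
  rewrite -cardCZ -prodr_const; apply: eq_big => [x|x /negbTE->//].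
  by rewrite inE.
pose M := D - U *m U^T.
have detM : \det M = a ^+ z * b ^+ (k * m) * (c / b) ^+ k.
  (* [D] acts as [b] on the columns of [U], which are supported outside [Z]. *)
  rewrite (@det_sub_mulmx _ _ _ D U (b^-1 *: U)); last first.
    by rewrite -scalemxAr DU scalerA mulVf // scale1r.
  rewrite -scalemxAr UU scale_scalar_mx -!rmorphN -!rmorphD /= det_scalar detD.
  by rewrite /c mulrBl divff // [b^-1 * _]mulrC.
have MZ : M *m indicator F Z = a *: indicator F Z.
  by rewrite mulmxBl DZ -mulmxA (incidenceT_indicator F partP) mulmx0 subr0.
have MCZ : M *m indicator F (~: Z) = c *: indicator F (~: Z).
  rewrite mulmxBl DCZ -mulmxA -indU (mulmxA U^T) UU.
  by rewrite mul_scalar_mx -scalemxAr -scalerBl.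
(* The two indicators are eigenvectors of [M] for [a] and [c], so the rank 2 correction reduces to a
   2 by 2 determinant. *)
rewrite -/M (@det_sub_mulmx _ _ _ M _
  (row_mx (a^-1 *: indicator F Z) (c^-1 *: indicator F (~: Z)))); last first.
  by rewrite mul_mx_row -!scalemxAr MZ MCZ !scalerA !mulVf // !scale1r.
rewrite mul_col_row -!scalemxAr !indicatorT_mulmx !setTI setIid setICr cards0.
rewrite cardCZ !scale_scalar_mx mulr0 scalar_mx_block.
rewrite opp_block_mx add_block_mx !add0r -!rmorphN -!rmorphD /= det_block_scalar2.
have Ea : a ^+ z = a * a ^+ z.-1 by rewrite -exprS prednK.
have Ec : c ^+ k = c * c ^+ k.-1 by rewrite -exprS prednK.
(* The factor [b ^+ k] is split off to cancel the denominator of [(c / b) ^+ k]. *)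
have Eb : b ^+ (k * m) = b ^+ (k * m.-1) * b ^+ k.
  by rewrite -exprD -mulnSr prednK.
have bk_nz : b ^+ k != 0 by rewrite expf_neq0.
rewrite detM Ea Eb expr_div_n Ec [(k * m * z)%:R]natrM -/z.
move: (a ^+ _) (b ^+ (_ * _)) (b ^+ k) (c ^+ _) (k * m)%:R z%:R bk_nz.
rewrite -/c in c_nz *; move: (c) c_nz a_nz; clear.
move=> c c_nz a_nz x1 x2 x3 x4 x5 x6 x3_nz.
by field; rewrite a_nz c_nz x3_nz.
Qed.

Lemma char_poly_join_cliques (F : numFieldType) (Gamma : sgraph)
    (Z : {set Gamma}) (P : {set {set Gamma}}) (m : nat) :
    partition P (~: Z) -> {in P, forall B : {set Gamma}, #|B| = m} ->
    (0 < #|Z|)%N -> (0 < #|P|)%N -> (0 < m)%N ->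
    (forall x y : Gamma, adj x y =
       (x != y) && [|| x \in Z, y \in Z | pblock P x == pblock P y]) ->
  let z := #|Z| in let k := #|P| in
  char_poly (signless_laplacian_mx F Gamma) =
    ('X - (z%:R + (k * m)%:R - 2)%:P) ^+ z.-1
    * ('X - (z%:R + m%:R - 2)%:P) ^+ (k * m.-1)
    * ('X - (z%:R + 2 * m%:R - 2)%:P) ^+ k.-1
    * (('X - (2 * z%:R + (k * m)%:R - 2)%:P) * ('X - (z%:R + 2 * m%:R - 2)%:P)
       - ((k * m * z)%:R)%:P).
Proof.
move=> partP cardP z_gt0 k_gt0 m_gt0 adjE z k.
have /and3P[/eqP coverP trivP _] := partP.
have cardCZ : #|~: Z| = (k * m)%N by apply: card_uniform_partition partP.
have degZ x : x \in Z -> (degree x)%:R = z%:R + (k * m)%:R - 1 :> F.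
  move=> xZ; rewrite /degree (_ : [set w | adj x w] = ~: [set x]); last first.
    by apply/setP=> y; rewrite !inE adjE xZ andbT eq_sym.
  rewrite -natrD -cardCZ cardsC cardsC1 -subn1 natrB //.
  by apply/card_gt0P; exists x.
have degCZ x : x \notin Z -> (degree x)%:R = z%:R + m%:R - 1 :> F.
  move=> xZ.
  have xP : x \in cover P by rewrite coverP inE.
  have cardPx : #|pblock P x| = m by rewrite cardP ?pblock_mem.
  have Zx0 : #|Z :&: pblock P x| = 0%N.
    apply/eqP; rewrite cards_eq0 setI_eq0 disjoint_sym disjoints_subset.
    by rewrite -coverP; apply: (bigcup_sup (pblock P x)); apply: pblock_mem.
  (* [Z :|: pblock P x] is the closed neighbourhood of [x]; removing [x] itself accounts for the
     [- 1]. *)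
  have := cardsD1 x (Z :|: pblock P x); rewrite cardsU Zx0 subn0 cardPx.
  rewrite in_setU mem_pblock xP orbT -natrD => ->.
  rewrite natrD addrC addKr; congr (_%:R); apply: eq_card => y.
  by rewrite !inE adjE (negPf xZ) eq_sym eq_pblock.
(* The roots of [r] are the values of [x] at which [a], [b] or [b - m%:R] vanishes. *)
pose r : {poly F} := ('X - (z%:R + (k * m)%:R - 2)%:P)
   * ('X - (z%:R + m%:R - 2)%:P) * ('X - (z%:R + 2 * m%:R - 2)%:P).
apply: (@eq_poly_generic _ r); first by rewrite !mulf_neq0 ?polyXsubC_eq0.
move=> x; rewrite /r !hornerE !mulf_eq0 !negb_or => /andP[/andP[a_nz b_nz] c_nz].
rewrite horner_char_poly.
(* Each is [x] minus the degree, plus 1 for the diagonal one subtracted with the cliques or the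
   join. *)
pose a := x - (z%:R + (k * m)%:R - 2); pose b := x - (z%:R + m%:R - 2).
have := @det_join_cliques F Gamma Z P m a b partP cardP z_gt0 k_gt0 m_gt0.
have Ec : b - m%:R = x - (z%:R + 2 * m%:R - 2) by rewrite /b; ring.
rewrite Ec => /(_ a_nz b_nz c_nz) /=.
set M := (X in \det X) => detM.
have -> : x%:M - signless_laplacian_mx F Gamma = M.
  rewrite /M (incidence_mulT _ partP).
  apply/matrixP=> i j; rewrite mul_row_col.
  rewrite !mxE !big_ord1 !mxE in_setT adjE (inj_eq enum_val_inj) in_setC.
  have [<-|ij] := eqVneq i j; last first.
    rewrite !mulr0n /= !sub0r.
    case: (boolP (enum_val i \in Z)) => iZ /=.
      by ring.
    by case: (boolP (enum_val j \in Z)) => jZ /=; rewrite ?mulr0n; ring.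
  rewrite !mulr1n eqxx /=.
  case: (boolP (enum_val i \in Z)) => iZ /=.
    by rewrite degZ // /a; ring.
  by rewrite degCZ // /b; ring.
rewrite detM -/a -/b; congr (_ * (_ * _ - _)).
by rewrite /a; ring.
Qed.

(** * Centralizers and commuting graph when the centre has index [p ^ 2] *)

Section CentreOfIndexPSquared.
Variables (gT : finGroupType) (G : {group gT}) (p n : nat).
Hypotheses (p_pr : prime p) (n_ge2 : (2 <= n)%N).
Hypotheses (cardG : #|G| = (p ^ n)%N) (cardZ : #|'Z(G)%g| = (p ^ (n - 2))%N).

Let p_gt1 : (1 < p)%N := prime_gt1 p_pr.

(** The order is a power of [p] strictly between [p ^ (n - 2)] and [p ^ n]. *)
Lemma card_between_center (H : {group gT}) :
  'Z(G)%g \proper H -> H \proper G -> #|H| = (p ^ (n - 1))%N.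
Proof.
move=> ltZH ltHG; have := cardSg (proper_sub ltHG).
rewrite cardG => /(dvdn_pfactor _ _ p_pr)[j le_jn cardH].
have := proper_card ltZH; have := proper_card ltHG.
rewrite cardG cardZ cardH !ltn_exp2l // => lt_jn lt_nj.
by congr (_ ^ _)%N; apply/eqP; rewrite eqn_leq leq_subRL ?ltn_subLR; lia.
Qed.

Lemma center_proper_subcent1 x :
  x \in G -> x \notin 'Z(G)%g -> 'Z(G)%g \proper 'C_G[x]%g.
Proof.
move=> Gx nZx; apply/properP; split; last by exists x; rewrite ?subcent1_id.
by rewrite setIS // -cent_set1 centS // sub1set.
Qed.

Lemma subcent1_proper x : x \in G -> x \notin 'Z(G)%g -> 'C_G[x]%g \proper G.
Proof.
move=> Gx nZx; rewrite properE subcent1_sub /=; apply: contra nZx => sGC.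
rewrite inE Gx -sub_cent1; exact: subset_trans sGC (subsetIr _ _).
Qed.

Lemma card_subcent1 x :
  x \in G -> x \notin 'Z(G)%g -> #|'C_G[x]%g| = (p ^ (n - 1))%N.
Proof.
move=> Gx nZx; apply: card_between_center.
  exact: center_proper_subcent1.
exact: subcent1_proper.
Qed.

(* The centre of C_G(x) contains both Z(G) and x, so it already has index p
   in G. *)
Lemma abelian_subcent1 x :
  x \in G -> x \notin 'Z(G)%g -> abelian 'C_G[x]%g.
Proof.
move=> Gx nZx; have ltCG := subcent1_proper Gx nZx.
have sZC : 'Z('C_G[x])%g \subset 'C_G[x]%g := center_sub _.
suff eqZC : 'Z('C_G[x])%g = 'C_G[x]%g by rewrite -eqZC center_abelian.
apply/eqP; rewrite eqEcard sZC /= card_subcent1 //.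
rewrite card_between_center //; last exact: sub_proper_trans sZC ltCG.
apply/properP; split.
  rewrite subsetI (proper_sub (center_proper_subcent1 Gx nZx)) /=.
  exact: subset_trans (subsetIr _ _) (centS (subcent1_sub _ _)).
exists x => //; rewrite inE subcent1_id //=.
by rewrite -sub_cent1 subsetIr.
Qed.

(** If [y] commutes with [x], it lies in the abelian group ['C_G[x]], which is therefore contained
    in ['C_G[y]]; the orders agree. Commuting is thus an equivalence relation on noncentral
    elements. *)
Lemma eq_subcent1 x y :
  x \in G -> x \notin 'Z(G)%g -> y \in G -> y \notin 'Z(G)%g ->
  ('C_G[x] == 'C_G[y])%g = (x * y == y * x)%g.
Proof.
move=> Gx nZx Gy nZy; apply/eqP/eqP => [eqC | cxy].
  have /subcent1P[_ cyx] : x \in 'C_G[y]%g by rewrite -eqC subcent1_id.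
  exact: esym cyx.
apply/eqP; rewrite eqEcard !card_subcent1 // leqnn andbT.
rewrite subsetI subcent1_sub sub_cent1.
apply: (subsetP (abelian_subcent1 Gx nZx)).
by apply/subcent1P.
Qed.

Lemma card_sgval_preim (A : {set gT}) :
  A \subset G -> #|[set x : subg_of G | sgval x \in A]| = #|A|.
Proof.
move=> sAG; rewrite -(card_imset _ val_inj); apply: eq_card => y.
apply/imsetP/idP => [[x xA ->] | yA]; first by rewrite inE in xA.
by exists (subg G y); rewrite ?inE /= subgK // (subsetP sAG).
Qed.

Let Z := [set x : commuting_graph G | sgval x \in 'Z(G)%g].
(** Grouping by centralizer makes this a partition by construction; that its blocks are the
    commuting classes is proved afterwards. *)
Let P := preim_partition (fun x : subg_of G => 'C_G[sgval x]%g) (~: Z).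

Let in_Z (x : commuting_graph G) : (x \in Z) = (sgval x \in 'Z(G)%g).
Proof. by rewrite [LHS]in_set. Qed.

Lemma commuting_graph_partition : partition P (~: Z).
Proof. exact: preim_partitionP. Qed.

Lemma pblock_commuting (x y : commuting_graph G) : x \notin Z -> y \notin Z ->
  (y \in pblock P x) = (sgval x * sgval y == sgval y * sgval x)%g.
Proof.
move=> nZx nZy; rewrite pblock_equivalence_partition ?in_setC //; last first.
  by move=> u v w _ _ _; split=> // /eqP->.
move: nZx nZy; rewrite !in_Z => nZx nZy.
by rewrite (eq_subcent1 (valP x) nZx (valP y) nZy).
Qed.

(** The block of [x] corresponds to ['C_G[x]] with ['Z(G)] removed. *)
Lemma card_commuting_block :
  {in P, forall B : {set subg_of G}, #|B| = (p ^ (n - 1) - p ^ (n - 2))%N}.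
Proof.
have /and3P[/eqP coverP trivP nP0] := commuting_graph_partition.
move=> B PB; have [x xB] : exists x, x \in B.
  by apply/set0Pn; apply: contraNneq nP0 => <-.
have xP : x \in ~: Z by rewrite -coverP; apply/bigcupP; exists B.
have nZx : sgval x \notin 'Z(G)%g by rewrite in_setC in_Z in xP.
rewrite -(def_pblock trivP PB xB) -cardZ -(card_subcent1 (valP x) nZx).
rewrite -(setIidPr (proper_sub (center_proper_subcent1 (valP x) nZx))) -cardsD.
rewrite -card_sgval_preim ?subDset ?subsetU ?subcent1_sub ?orbT //.
apply: eq_card => y; rewrite [RHS]in_set in_setD.
have [yZ /=|nyZ /=] := boolP (sgval y \in 'Z(G)%g).
  apply/negbTE; have: y \notin cover P by rewrite coverP in_setC in_Z negbK.
  apply: contra => yB; apply/bigcupP; exists (pblock P x) => //.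
  by rewrite pblock_mem // coverP.
by rewrite pblock_commuting ?in_Z //= inE (valP y) cent1E eq_sym.
Qed.

Lemma commuting_graph_join_cliques (x y : commuting_graph G) :
  adj x y = (x != y) && [|| x \in Z, y \in Z | pblock P x == pblock P y].
Proof.
have /and3P[/eqP coverP trivP _] := commuting_graph_partition.
rewrite /=; congr (_ && _).
transitivity (sgval x * sgval y == sgval y * sgval x)%g.
  by apply/eqP/eqP => [/(congr1 sgval) | ?] //; exact: val_inj.
case: (boolP (x \in Z)) => [|nZx] /=.
  rewrite in_Z => /centerP[_ cx]; rewrite cx ?eqxx //; exact: valP.
case: (boolP (y \in Z)) => [|nZy] /=.
  rewrite in_Z => /centerP[_ cy]; rewrite cy ?eqxx //; exact: valP.
by rewrite eq_pblock ?coverP ?in_setC // pblock_commuting.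
Qed.

End CentreOfIndexPSquared.

(** * From characteristic polynomials to spectra *)

(** Root multiplicities add up under products of nonzero polynomials. *)
Lemma Spec_prod (C : numClosedFieldType) (l : nat) (M : 'M[C]_l)
    (k : nat) (N : 'M[C]_k) (n1 n2 n3 : nat) (x1 x2 x3 : C) :
    char_poly M = char_poly N
      * (('X - x1%:P) ^+ n1 * ('X - x2%:P) ^+ n2 * ('X - x3%:P) ^+ n3) ->
  Spec M = (Spec N `+` (msetn n1 x1 `+` msetn n2 x2 `+` msetn n3 x3))%mset.
Proof.
move=> eqMN; apply/msetP => x; rewrite Spec_mup eqMN !msetE2 !msetnE Spec_mup.
have nz y m : ('X - y%:P) ^+ m != 0 :> {poly C}.
  by rewrite expf_neq0 ?polyXsubC_eq0.
have nzN : char_poly N != 0 by rewrite monic_neq0 ?char_poly_monic.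
rewrite mupM ?mulf_neq0 // !mupM ?mulf_neq0 // !mup_XsubCX.
by rewrite ![x == _]eq_sym.
Qed.

Lemma char_poly_block_scalar2 (R : comNzRingType) (a b c d : R) :
  char_poly (block_mx a%:M b%:M c%:M d%:M : 'M_(1 + 1)) =
  ('X - a%:P) * ('X - d%:P) - (b * c)%:P.
Proof.
rewrite /char_poly /char_poly_mx (scalar_mx_block 1 1) map_block_mx.
rewrite !map_scalar_mx opp_block_mx add_block_mx !add0r -!rmorphN -!rmorphD /=.
by rewrite det_block_scalar2 !polyCN mulrNN polyCM.
Qed.

Theorem theorem6p1 (C : numClosedFieldType) (gT : finGroupType)
    (G : {group gT}) (p n : nat) (p_prime : prime p) (p_odd : odd p)
    (n_ge2 : (2 <= n)%N)
    (cardG : #|G| = (p ^ n)%N) (cardZ : #|'Z(G)%g| = (p ^ (n - 2))%N) :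
  let A : {mset C}%mset :=
    (msetn (p ^ (n - 2) - 1)%N (p%:R ^+ n - 2)
     `+` msetn p (2 * p%:R ^+ (n - 1) - p%:R ^+ (n - 2) - 2)
     `+` msetn (p ^ n - p ^ (n - 2) - p - 1)%N (p%:R ^+ (n - 1) - 2))%mset in
  Spec_Q C (commuting_graph G) = (Spec (CQ_S1 C p n) `+` A)%mset.
Proof.
move=> A; apply: Spec_prod.
pose Z := [set x : commuting_graph G | sgval x \in 'Z(G)%g].
pose P := preim_partition (fun x : subg_of G => 'C_G[sgval x]%g) (~: Z).
pose m := (p ^ (n - 1) - p ^ (n - 2))%N.
have partP : partition P (~: Z) := commuting_graph_partition G.
have cardP : {in P, forall B : {set subg_of G}, #|B| = m}.
  exact: card_commuting_block.
have p_gt1 := prime_gt1 p_prime.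
(* With [n = s.+2] the truncated subtractions [n - 1] and [n - 2] become [s.+1] and [s]. *)
have [s def_n] : exists s, n = s.+2 by exists n.-2; lia.
have q_gt0 : (0 < p ^ s)%N by rewrite expn_gt0 prime_gt0.
have def_m : m = (p.-1 * p ^ s)%N.
  by rewrite /m def_n !subSS !subn0 expnS -subn1 mulnBl mul1n.
have m_gt0 : (0 < m)%N by rewrite def_m muln_gt0 q_gt0 andbT; lia.
have cardZs : #|Z| = (p ^ s)%N.
  by rewrite card_sgval_preim ?center_sub // cardZ def_n !subSS subn0.
(* Counting noncentral elements gives [p ^ s.+2 - p ^ s = #|P| * (p.-1 * p ^ s)]; both [p.-1] and
   [p ^ s] are positive and cancel. *)
have card_P : #|P| = p.+1.
  have cardT : #|subg_of G| = (p ^ n)%N.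
    rewrite -cardG -(card_sgval_preim (subxx G)).
    by apply: eq_card => x; rewrite in_set (valP x).
  have := cardsC Z; rewrite (card_uniform_partition cardP partP) cardZs cardT.
  rewrite def_m def_n !expnS; move: (p ^ s)%N q_gt0 #|P| => q q_gt0 k.
  have [r r_gt0 ->] : exists2 r, (0 < r)%N & p = r.+1 by exists p.-1; lia.
  move=> eq_card; apply/eqP; rewrite -(eqn_pmul2r r_gt0) -(eqn_pmul2r q_gt0).
  by apply/eqP; move: eq_card; rewrite /=; lia.
have := @char_poly_join_cliques C (commuting_graph G) Z P m partP cardP.
rewrite cardZs card_P => /(_ q_gt0 isT m_gt0) ->; last first.
  exact: (commuting_graph_join_cliques p_prime n_ge2 cardG cardZ).
rewrite /CQ_S1 char_poly_block_scalar2 /=.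
have -> : (p.+1 * m.-1)%N = (p ^ n - p ^ (n - 2) - p - 1)%N.
  rewrite def_m def_n !subSS subn0 !expnS; move: (p ^ s)%N q_gt0 => q q_gt0.
  have [r ->] : exists r, p = r.+1 by exists p.-1; lia.
  by rewrite /= -subn1 mulnBr; lia.
have -> : (p ^ s).-1 = (p ^ (n - 2) - 1)%N by rewrite def_n !subSS subn0 subn1.
pose x : C := p%:R; pose y := x ^+ s.
have Cz : (p ^ s)%:R = y by rewrite natrX.
have Cm : m%:R = (x - 1) * y.
  by rewrite def_m -subn1 natrM Cz natrB // prime_gt0.
have Ck : p.+1%:R = x + 1 by rewrite -addn1 natrD.
have xn : x ^+ n = x ^+ 2 * y by rewrite def_n -exprD.
have xn1 : x ^+ (n - 1) = x * y by rewrite def_n !subSS subn0 exprS.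
have xn2 : x ^+ (n - 2) = y by rewrite def_n !subSS subn0.
rewrite -/x xn xn1 xn2 !natrM Cz Cm Ck.
(* The square of the off-diagonal entry of [CQ_S1] is [y ^+ 2 * (x ^+ 2 - 1)], which matches the
   constant [k * m * z] of the quadratic factor. *)
rewrite mulrACA -!expr2 sqrtCK.
have -> : y + (x + 1) * ((x - 1) * y) - 2 = x ^+ 2 * y - 2 by ring.
have -> : y + (x - 1) * y - 2 = x * y - 2 by ring.
have -> : y + 2 * ((x - 1) * y) - 2 = 2 * (x * y) - y - 2 by ring.
have -> : 2 * y + (x + 1) * ((x - 1) * y) - 2 = y + x ^+ 2 * y - 2 by ring.
have -> : (x + 1) * ((x - 1) * y) * y = y ^+ 2 * (x ^+ 2 - 1) by ring.
(* Only the order of the factors differs: the quadratic one comes first, and the last two linear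
   powers are exchanged. *)
by rewrite mulrC [X in _ * X]mulrAC.
Qed.
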